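(* For every integer $d \geq 3$ and every integer $r \geq \lfloor \frac{d+3}{2} \rfloor$, \[ T\left(d,r,\left\lfloor \tfrac{d+3}{2} \right\rfloor\right)=(d+1)(r-1)+1. \]
   Context: For integers $d\geq 1$ and $2\leq k\leq r$, $T(d,r,k)$ denotes the smallest positive integer $n$ with the following property: for any list $a_1,\dots,a_n$ of (not necessarily distinct) points in $\mathbb{R}^d$, there is a partition of the index set $\{1,\dots,n\}$ into $r$ disjoint parts $N_1,\dots,N_r$ such that every $k$ of the $r$ convex hulls $\mathrm{conv}\{a_i : i\in N_j\}$ ($j=1,\dots,r$) have a point in common. *)

(* Defs.v *)
From mathcomp Require Import all_boot all_order all_algebra.
From mathcomp Require Import boolp classical_sets reals convex.

Set Implicit Arguments.
Unset Strict Implicit.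
Unset Printing Implicit Defensive.

Local Open Scope classical_set_scope.

Definition conv_hull (R : realType) (d : nat) (A : set 'rV[R]_d) :
    set 'rV[R]_d :=
  smallest (@convex_set R 'rV[R]_d) A.

(* Blocks may be empty a priori; when 1 <= k <= r the last clause excludes
   this, as the hull of an empty block is empty. *)
Definition reay_partition (R : realType) (d r k n : nat)
    (a : 'I_n -> 'rV[R]_d) (N : 'I_r -> {set 'I_n}) : Prop :=
  [/\ forall i j : 'I_r, i != j -> [disjoint N i & N j]%bool,
      (\bigcup_(j < r) N j)%SET = [set: 'I_n]%SET &
      forall J : {set 'I_r}, #|J| = k ->
        \bigcap_(j in [set` J]) conv_hull (a @` [set` N j]) !=set0].

Definition reay_property (R : realType) (d r k n : nat) : Prop :=
  forall a : 'I_n -> 'rV[R]_d,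
    exists N : 'I_r -> {set 'I_n}, reay_partition k a N.

(* The number T(d, r, k): the least positive n with the property, and 0 by
   convention when there is none. Hence T R d r k = m with 0 < m asserts both
   that such an n exists and that m is the least one. *)
Definition T (R : realType) (d r k : nat) : nat :=
  match pselect (exists n, `[< (0 < n)%N /\ reay_property R d r k n >]) with
  | left ex_n => ex_minn ex_n
  | right _ => 0
  end.

(* Main.v *)
Require Import Defs.
From mathcomp Require Import all_boot all_order all_algebra.
From mathcomp Require Import zify.

(** Upper bound: Tverberg's theorem, by Sarkaria's tensor trick from Bárány's
    colourful Carathéodory theorem, which is proved by minimizing the norm over
    rainbow simplices.

    Lower bound: put at most [r - 1] points on each of [d + 1] rays from the
    origin whose directions are the vertices of a simplex around it, at heights
    that grow geometrically. By pigeonhole every ray is missed by some part. A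
    part that misses a ray has its hull in a proper face of the complete
    simplicial fan of the rays, so a common point of several such hulls has the
    same nonnegative coordinates with respect to all of them, and lies on the
    rays [S] that none of these parts misses. A greedy choice gives [k] of them
    such that more than [#|S|] have at most one point on each ray of [S]; each
    of those puts weight at least [1 / (d + 1)] on some ray of [S], two of them
    on the same ray, and then the geometric growth of the heights is violated. *)

Set Implicit Arguments.
Unset Strict Implicit.
Unset Printing Implicit Defensive.

(** * Selecting parts by the rays that they miss *)

Lemma superset_of_card (T : finType) (A : {set T}) k :
  (#|A| <= k <= #|T|) -> exists2 B : {set T}, A \subset B & #|B| = k.
Proof.
elim: k => [|k IHk] /andP[Ak kT].
  by exists A => //; apply/eqP; rewrite -leqn0.
move: Ak; rewrite leq_eqVlt => /predU1P[Ak|Ak]; first by exists A.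
have [|B AB Bk] := IHk; first by rewrite -ltnS Ak ltnW.
have [x xB] : exists x, x \notin B.
  apply/existsP; rewrite -negb_forall; apply: contraTN kT => /forallP BT.
  by rewrite -leqNgt -Bk subset_leq_card//; apply/subsetP => x _.
exists (x |: B); last by rewrite cardsU1 xB Bk.
exact: subset_trans AB (subsetUr _ _).
Qed.

(* [m j c] is the number of points of part [j] on ray [c]. Summed over all parts,
   the rays of [S] missed by a part outnumber its surplus points on [S], so some
   part misses more rays of [S] than it has surplus points on [S]; adding it to
   [J] keeps [#|J| + #|bad J| + #|S J| <= #|W|]. *)
Lemma few_parts_missing_rays (P W : finType) (m : P -> W -> nat) k :
  (0 < #|W| < k.*2) -> (forall c, \sum_j m j c < #|P|) ->
  exists (J : {set P}) (S : {set W}), [/\ (#|J| <= k),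
    forall j, j \in J -> exists c, m j c = 0,
    forall c, c \notin S -> exists2 j, j \in J & m j c = 0 &
    (#|S| < #|[set j in J | [forall c in S, m j c <= 1]]|)].
Proof.
move=> /andP[W0 Wk] mP.
(* [S J] collects the rays met by every part of [J]; a part of [J] is bad if it has two or more
   points on one of them. *)
pose S (J : {set P}) := [set c | [forall j in J, m j c != 0]].
pose bad (J : {set P}) := [set j in J | ~~ [forall c in S J, m j c <= 1]].
pose ok (J : {set P}) := [&& #|J| <= k, #|J| + #|bad J| + #|S J| <= #|W| &
  [forall j in J, exists c, m j c == 0]].
have ok0 : ok set0.
  rewrite /ok cards0 /= add0n; apply/andP; split; last first.
    by apply/forall_inP => j; rewrite inE.
  rewrite [bad _](_ : _ = set0) ?cards0 ?max_card//.
  by apply/setP => j; rewrite !inE.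
have [J /and3P[Jk JW Jmiss] Jmax] := arg_maxnP (fun J : {set P} => #|J|) ok0.
have good_bad : (#|[set j in J | [forall c in S J, m j c <= 1]]| + #|bad J| = #|J|).
  rewrite -(cardsID [set j | [forall c in S J, m j c <= 1]] J).
  congr (_ + _); apply: eq_card => j; rewrite !inE//.
  by rewrite andbC.
exists J, (S J); split=> //.
- by move=> j /(forall_inP Jmiss) /existsP[c /eqP]; exists c.
- move=> c; rewrite inE => /forall_inPn[j jJ]; rewrite negbK => /eqP.
  by exists j.
(* With no ray left, all parts of [J] are vacuously good, and [J] is nonempty since [S set0] is all
   of [W]. *)
have [SJ0|SJ0] := eqVneq (S J) set0.
  rewrite SJ0 cards0 -SJ0.
  have -> : [set j in J | [forall c in S J, m j c <= 1]] = J.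
    apply/setP => j; rewrite inE SJ0; case: (j \in J) => //=.
    by apply/forall_inP => c; rewrite inE.
  rewrite lt0n; apply: contraTneq W0 => /cards0_eq J0.
  rewrite -eqn0Ngt -cardsT cards_eq0 -subset0 -SJ0.
  by apply/subsetP => c _; rewrite inE; apply/forall_inP => j; rewrite J0 inE.
(* If [k <= #|J|], the invariant gives [#|S J| + #|bad J| <= #|W| - #|J| < #|J|]. *)
suff kJ : (k <= #|J|) by lia.
rewrite leqNgt; apply/negP => Jk'.
have [j jS] : exists j,
    (\sum_(c in S J) (m j c).-1 < \sum_(c in S J) (m j c == 0)).
  apply/existsP; rewrite -[X in is_true X]negbK negb_exists; apply/negP => /forallP jS.
  have : (\sum_j \sum_(c in S J) (m j c == 0) <=
          \sum_j \sum_(c in S J) (m j c).-1).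
    by apply: leq_sum => j _; rewrite leqNgt.
  rewrite exchange_big [X in _ <= X]exchange_big /= leqNgt => /negP; apply.
  have [c0 c0S] := set0Pn _ SJ0.
  have lt_c c : (\sum_j (m j c).-1 < \sum_j (m j c == 0)).
    have : (\sum_j (m j c + (m j c == 0)) = \sum_j ((m j c).-1 + 1)).
      by apply: eq_bigr => j _; case: (m j c) => [|p] //=; rewrite addn0 addn1.
    rewrite !big_split/= sum1_card.
    by have := mP c; rewrite (eq_card (B := P))//; lia.
  rewrite (bigD1 c0)// [X in _ < X](bigD1 c0)//=.
  by rewrite -addSn leq_add// leq_sum// => c _; exact: ltnW.
have [c cS mjc] : exists2 c, c \in S J & m j c = 0.
  have [/exists_inP[c cS /eqP]|] := boolP [exists c in S J, m j c == 0].
    by exists c.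
  move=> /exists_inPn noc; move: jS; rewrite [X in _ < X]big1// => c cS.
  by rewrite (negPf (noc c cS)).
have jJ : j \notin J.
  by apply: contraTN cS => jJ; rewrite inE; apply/forall_inPn; exists j; rewrite // mjc.
suff /Jmax : ok (j |: J) by rewrite /= cardsU1 jJ add1n ltnn.
have SU : S (j |: J) = S J :\: [set c | m j c == 0].
  apply/setP => c'; rewrite !inE; apply/forall_inP/andP => [nz|[mj /forall_inP nz] j'].
    split; first by apply: nz; rewrite setU11.
    by apply/forall_inP => j' j'J; apply: nz; rewrite setU1r.
  by rewrite in_setU1 => /predU1P[->//|]; exact: nz.
have SUsub : S (j |: J) \subset S J by rewrite SU subsetDl.
have cardSU : (#|S (j |: J)| + \sum_(c in S J) (m j c == 0) = #|S J|).
  rewrite SU -(cardsID [set c | m j c == 0] (S J)) addnC; congr (_ + _).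
  rewrite -sum1_card big_mkcond [RHS]big_mkcond; apply: eq_bigr => c' _ /=.
  by rewrite !inE; case: [forall _ in _, _]; case: (_ == _).
(* Shrinking [S J] turns no good part bad, so only [j] can be newly bad, and only with surplus
   points on [S J]. *)
have badU : (#|bad (j |: J)| <= #|bad J| + (0 < \sum_(c in S J) (m j c).-1)).
  have sub_bad : bad (j |: J) \subset
      (bad J :|: [set j' | (j' == j) && (0 < \sum_(c in S J) (m j c).-1)]).
    apply/subsetP => j'; rewrite !inE.
    move=> /andP[/orP[/eqP ->|j'J] /forall_inPn[c' c'S c'm]]; apply/orP; [right|left].
      rewrite eqxx/= (bigD1 c') ?(subsetP SUsub)//=.
      by move: c'm; rewrite -ltnNge; case: (m j c') => [|[]].
    rewrite j'J/=; apply/forall_inPn; exists c' => //.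
    exact: (subsetP SUsub).
  apply: leq_trans (subset_leq_card sub_bad) _.
  apply: leq_trans (leq_card_setU _ _) _; rewrite leq_add2l.
  case: (0 < _); last by rewrite eq_card0// => ?; rewrite !inE andbF.
  by rewrite (eq_card (B := pred1 j)) ?card1// => ?; rewrite !inE andbT.
apply/and3P; split.
- by rewrite cardsU1 jJ.
(* At least one ray leaves [S J], and at least two if [j] has a surplus; this pays for [j] and for
   its possible badness. *)
- by rewrite cardsU1 jJ; move: badU; case: posnP jS cardSU JW => /= [->|]; lia.
- apply/forall_inP => j'; rewrite in_setU1 => /predU1P[->|];
    last exact: (forall_inP Jmiss).
  by apply/existsP; exists c; rewrite mjc.
Qed.

(* Imported late because [classical_sets] shadows lemmas of [finset]. *)
From mathcomp Require Import unstable boolp classical_sets reals convex.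
From mathcomp Require Import interval_inference topology normedtype derive.
From mathcomp Require Import ring lra.

Import Order.TTheory GRing.Theory Num.Theory numFieldNormedType.Exports.

Local Open Scope classical_set_scope.
Local Open Scope ring_scope.

(** * Convex hulls as sets of weighted means *)

(** Dividing by the total weight lets an induction on the list merge one point with the mean of the
    rest. *)
Lemma convex_set_normalized_sum (R : realType) (d : nat) (C : set 'rV[R]_d)
    (I : eqType) (s : seq I) (w : I -> R) (a : I -> 'rV[R]_d) :
  convex_set C -> (forall i, 0 <= w i) -> (forall i, 0 < w i -> C (a i)) ->
  0 < \sum_(i <- s) w i ->
  C ((\sum_(i <- s) w i)^-1 *: \sum_(i <- s) w i *: a i).
Proof.
move=> convC w0 aC; elim: s => [|i s IHs]; first by rewrite big_nil ltxx.
rewrite !big_cons; set W := \sum_(j <- s) w j; set X := \sum_(j <- s) _.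
have W0 : 0 <= W by apply: sumr_ge0.
have [wi0|wi0] := eqVneq (w i) 0; first by rewrite wi0 scale0r !add0r.
have {}wi0 : 0 < w i by rewrite lt_def wi0 w0.
have [WE|WN] := eqVneq W 0.
  move=> _; have -> : X = 0.
    rewrite /X big_seq big1 // => j js.
    move: WE => /eqP; rewrite psumr_eq0// => /allP/(_ _ js)/= /eqP ->.
    by rewrite scale0r.
  by rewrite WE !addr0 scalerA mulVf ?gt_eqF// scale1r; exact: aC.
have {}WN : 0 < W by rewrite lt_def WN.
move=> sum0.
have l0 : 0 <= w i / (w i + W) by rewrite divr_ge0// ltW.
have l1 : w i / (w i + W) <= 1 by rewrite ler_pdivrMr// mul1r lerDl.
have := convC (a i) (W^-1 *: X) (Itv01 l0 l1).
rewrite !inE => /(_ (aC _ wi0) (IHs WN)).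
rewrite /conv/=; congr C.
rewrite /onem scalerDr !scalerA; congr (_ *: _ + _ *: _); first by rewrite mulrC.
by field; rewrite !gt_eqF.
Qed.

(** The weighted means form a convex set containing the points, and every convex set containing the
    points contains them. *)
Lemma conv_hullP (R : realType) (d n : nat) (a : 'I_n -> 'rV[R]_d)
    (A : {set 'I_n}) (x : 'rV[R]_d) :
  conv_hull (a @` [set` A]) x <->
  exists w : 'I_n -> R, [/\ forall i, 0 <= w i, forall i, i \notin A -> w i = 0,
    \sum_i w i = 1 & x = \sum_i w i *: a i].
Proof.
split=> [|[w [w0 wA w1 ->]]].
  move: x; apply: smallest_sub => [x y l|_ [i /= iA <-]].
    rewrite !inE => -[u [u0 uA u1 ->]] [v [v0 vA v1 ->]].
    exists (fun i => l%:num * u i + (1 - l%:num) * v i); split.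
    - by move=> i; rewrite addr_ge0// mulr_ge0// subr_ge0.
    - by move=> i iA; rewrite uA// vA// !mulr0 addr0.
    - by rewrite big_split -!mulr_sumr/= u1 v1; ring.
    - rewrite /conv/= /onem !scaler_sumr -big_split /=.
      under [RHS]eq_bigr do rewrite scalerDl -!scalerA.
      by [].
  exists (fun j => (j == i)%:R); split=> [j|j jA||].
  - exact: ler0n.
  - by case: eqP jA => // ->; rewrite iA.
  - by rewrite (bigD1 i)//= eqxx big1 ?addr0// => j /negPf ->.
  - rewrite (bigD1 i)//= eqxx scale1r big1 ?addr0// => j /negPf ->.
    by rewrite scale0r.
move=> C [convC sub]; have := @convex_set_normalized_sum R d C _
  (index_enum 'I_n) w a convC w0.
rewrite w1 invr1 scale1r; apply=> // i wi; apply: sub; exists i => //=.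
by apply: contraTT wi => /wA ->; rewrite ltxx.
Qed.

(** * The point of a simplex nearest to the origin *)

Definition std_simplex (R : realType) (n : nat) : set 'rV[R]_n :=
  [set w | (forall i, 0 <= w 0 i) /\ \sum_i w 0 i = 1].

Definition dot (R : realType) (n : nat) (x y : 'rV[R]_n) : R :=
  \sum_i x 0 i * y 0 i.

Lemma dotC (R : realType) n (x y : 'rV[R]_n) : dot x y = dot y x.
Proof. by apply: eq_bigr => i _; rewrite mulrC. Qed.

Lemma dotDr (R : realType) n (x y z : 'rV[R]_n) :
  dot x (y + z) = dot x y + dot x z.
Proof. by rewrite -big_split; apply: eq_bigr => i _; rewrite mxE mulrDr. Qed.

Lemma dotZr (R : realType) n c (x y : 'rV[R]_n) : dot x (c *: y) = c * dot x y.
Proof. by rewrite mulr_sumr; apply: eq_bigr => i _; rewrite mxE mulrCA. Qed.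

Lemma dot0r (R : realType) n (x : 'rV[R]_n) : dot x 0 = 0.
Proof. by rewrite -(scale0r 0) dotZr mul0r. Qed.

Lemma dot_sumr (R : realType) n (I : finType) (x : 'rV[R]_n) (y : I -> 'rV[R]_n) :
  dot x (\sum_i y i) = \sum_i dot x (y i).
Proof.
rewrite /dot exchange_big; apply: eq_bigr => i _ /=.
by rewrite summxE mulr_sumr.
Qed.

Lemma dot_ge0 (R : realType) n (x : 'rV[R]_n) : 0 <= dot x x.
Proof. by apply: sumr_ge0 => i _; rewrite -expr2 sqr_ge0. Qed.

Lemma dot_gt0 (R : realType) n (x : 'rV[R]_n) : x != 0 -> 0 < dot x x.
Proof.
move=> x0; rewrite lt_def dot_ge0 andbT; apply: contra x0 => x0.
apply/eqP/rowP => i; move: x0; rewrite psumr_eq0; last first.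
  by move=> j _; rewrite -expr2 sqr_ge0.
by move=> /allP/(_ i); rewrite mem_index_enum => /(_ isT)/=;
  rewrite mulf_eq0 orbb mxE => /eqP.
Qed.

(** With [d = dot x x - dot x v] and [E] the squared length of [v - x], the squared norm drops by
    [t * (2 * d - t * E)], which is positive at [t = d / (d + E)]. *)
Lemma dot_segment_lt (R : realType) n (x v : 'rV[R]_n) : dot x v < dot x x ->
  exists t, [/\ 0 <= t, t <= 1 &
    dot ((1 - t) *: x + t *: v) ((1 - t) *: x + t *: v) < dot x x].
Proof.
move=> xv; set d := dot x x - dot x v; have d0 : 0 < d by rewrite subr_gt0.
pose E := dot (v + (-1) *: x) (v + (-1) *: x).
have E0 : 0 <= E by exact: dot_ge0.
have dE : 0 < d + E by rewrite ltr_wpDr.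
exists (d / (d + E)); set t := d / (d + E).
have t0 : 0 < t by rewrite divr_gt0.
have t1 : t <= 1 by rewrite ler_pdivrMr// mul1r lerDl.
split=> //; first exact: ltW.
have -> : dot ((1 - t) *: x + t *: v) ((1 - t) *: x + t *: v) =
    dot x x - t * (2 * d - t * E).
  rewrite /d /E !(dotDr, dotZr) !(dotC (_ + _)) !(dotDr, dotZr) (dotC v x).
  by ring.
rewrite gtrBl mulr_gt0//.
have : t * E <= d by rewrite /t -mulrAC ler_pdivrMr// ler_pM2l// lerDr ltW.
by lra.
Qed.

Lemma compact_std_simplex (R : realType) n : compact (@std_simplex R n).
Proof.
have -> : @std_simplex R n =
    [set w | forall i, `[0, 1]%classic (w ord0 i)] `&`
    [set w | \sum_i w 0 i = 1].
  apply/seteqP; split=> w /=.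
    move=> [w0 w1]; split=> // i; rewrite in_itv/= w0/= -w1 (bigD1 i)//= lerDl.
    exact: sumr_ge0.
  by move=> [w01 w1]; split=> // i; have := w01 i; rewrite in_itv/= => /andP[].
apply: compact_closedI.
  by apply: (@rV_compact R n (fun=> `[0, 1]%classic)) => i; exact: segment_compact.
have cont : continuous (fun w : 'rV[R]_n => \sum_i w 0 i).
  apply: continuous_big => [|i _]; first exact: add_continuous.
  exact: coord_continuous.
exact: (continuous_closedP _).1 cont _ (@closed_eq _ 1).
Qed.

Lemma nearest_point_simplex (R : realType) n D (V : 'M[R]_(n.+1, D)) :
  exists2 w, std_simplex w &
    forall w', std_simplex w' -> dot (w *m V) (w *m V) <= dot (w' *m V) (w' *m V).
Proof.
pose f (w : 'rV[R]_n.+1) := dot (w *m V) (w *m V).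
have [||w] := EVT_min_rV (f := f) _ (@compact_std_simplex R n.+1).
- exists (delta_mx 0 0); split=> [i|].
    by rewrite mxE; exact: ler0n.
  by rewrite (bigD1 0)//= mxE eqxx big1 ?addr0// => i /negPf i0; rewrite mxE i0.
- apply: continuous_subspaceT => w.
  have cont i : continuous (fun w : 'rV[R]_n.+1 => (w *m V) 0 i).
    under eq_fun do rewrite mxE.
    apply: continuous_big => [|j _]; first exact: add_continuous.
    move=> x; apply: (@continuousM R 'rV[R]_n.+1); last exact: cst_continuous.
    exact: coord_continuous.
  apply: continuous_big => [|i _]; first exact: add_continuous.
  by move=> x; apply: (@continuousM R 'rV[R]_n.+1); exact: cont.
rewrite inE => ws wmin; exists w => // w' w's; apply: wmin.
by rewrite inE.
Qed.

Lemma std_simplex_delta (R : realType) n (i : 'I_n) :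
  std_simplex (delta_mx 0 i : 'rV[R]_n).
Proof.
split=> [j|]; first by rewrite mxE; exact: ler0n.
by rewrite (bigD1 i)//= mxE !eqxx big1 ?addr0// => j /negPf ij; rewrite mxE ij andbF.
Qed.

Lemma std_simplex_segment (R : realType) n (t : R) (u v : 'rV[R]_n) :
  0 <= t -> t <= 1 -> std_simplex u -> std_simplex v ->
  std_simplex ((1 - t) *: u + t *: v).
Proof.
move=> t0 t1 [u0 u1] [v0 v1]; split=> [i|].
  by rewrite !mxE addr_ge0// mulr_ge0// subr_ge0.
under eq_bigr do rewrite !mxE.
by rewrite big_split -!mulr_sumr/= u1 v1 !mulr1 subrK.
Qed.

(* Carathéodory inside the hyperplane [dot x _ = dot x x]: when all weights are
   positive, a linear relation between the rows is orthogonal to [x], hence an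
   affine one, along which the weights can be moved until one vanishes. *)
Lemma nearest_point_drop (R : realType) n D (V : 'M[R]_(n, D)) (w : 'rV[R]_n) :
  (D < n)%N -> std_simplex w -> w *m V != 0 ->
  (forall i, dot (w *m V) (w *m V) <= dot (w *m V) (row i V)) ->
  exists u i, [/\ std_simplex u, u *m V = w *m V & u 0 i = 0].
Proof.
move=> Dn [w0 w1]; set x := w *m V => x0 xV; set q := dot x x.
have q0 : 0 < q by exact: dot_gt0.
have sumV (u : 'rV_n) : u *m V = \sum_i u 0 i *: row i V by exact: mulmx_sum_row.
have [[i wi0]|/forallNP wN0] := pselect (exists i, w 0 i = 0).
  by exists w, i.
have wpos i : 0 < w 0 i by rewrite lt_def w0 andbT; exact/eqP/wN0.
(* The differences [dot x (row i V) - q] are nonnegative and their mean with positive weights is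
   0. *)
have xVq i : dot x (row i V) = q.
  have : \sum_i w 0 i * (dot x (row i V) - q) = 0.
    under eq_bigr do rewrite mulrBr -dotZr.
    by rewrite sumrB -dot_sumr -sumV -mulr_suml w1 mul1r subrr.
  move=> /eqP; rewrite psumr_eq0; last first.
    by move=> j _; rewrite mulr_ge0// subr_ge0.
  move=> /allP/(_ i); rewrite mem_index_enum => /(_ isT)/=.
  by rewrite mulf_eq0 gt_eqF//= subr_eq0 => /eqP.
have [m mV m0] : exists2 m : 'rV_n, m *m V = 0 & m != 0.
  have : kermx V != 0.
    rewrite kermx_eq0 /row_free neq_ltn; apply/orP; left.
    exact: leq_ltn_trans (rank_leq_col V) Dn.
  by move=> /rowV0Pn[m /sub_kermxP mV m0]; exists m.
have m1 : \sum_i m 0 i = 0.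
  have /eqP : dot x (m *m V) = 0.
    by rewrite mV dot0r.
  rewrite sumV dot_sumr; under eq_bigr do rewrite dotZr xVq.
  by rewrite -mulr_suml mulf_eq0 (gt_eqF q0) orbF => /eqP.
have [i0 mi0] : exists i, 0 < m 0 i.
  apply: contrapT => /forallNP mN; case/eqP: m0; apply/rowP => i; rewrite mxE.
  have mle j : m 0 j <= 0 by rewrite leNgt; apply/negP/mN.
  have : \sum_j - m 0 j == 0 by rewrite sumrN m1 oppr0.
  rewrite psumr_eq0 => [/allP/(_ i)|j _]; last by rewrite oppr_ge0.
  by rewrite mem_index_enum oppr_eq0 => /(_ isT)/= /eqP.
(* The least ratio is the longest step along [- m] that keeps all weights nonnegative; the weight
   attaining it vanishes. *)
case: (arg_minP (fun i => w 0 i / m 0 i) (P := fun i => 0 < m 0 i) mi0).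
move=> i mi imin; set s := w 0 i / m 0 i.
have s0 : 0 <= s by rewrite divr_ge0// ltW.
exists (w - s *: m), i; split.
- split=> [j|].
    rewrite !mxE subr_ge0; have [mj|mj] := ltP 0 (m 0 j).
      by rewrite -ler_pdivlMr//; exact: imin.
    by apply: le_trans (w0 j); rewrite mulr_ge0_le0.
  under eq_bigr do rewrite !mxE.
  by rewrite sumrB -mulr_sumr m1 mulr0 subr0.
- by rewrite mulmxBl -scalemxAl mV scaler0 subr0.
- by rewrite !mxE divfK ?subrr// gt_eqF.
Qed.

(** * The colourful Carathéodory theorem *)

Lemma colorful_caratheodory (R : realType) (n r D : nat)
    (V : 'I_n.+1 -> 'I_r -> 'rV[R]_D) (u : 'I_n.+1 -> 'I_r -> R) :
  (D <= n)%N -> (forall i j, 0 <= u i j) -> (forall i, \sum_j u i j = 1) ->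
  (forall i, \sum_j u i j *: V i j = 0) ->
  exists (f : 'I_n.+1 -> 'I_r) (w : 'rV[R]_n.+1),
    std_simplex w /\ \sum_i w 0 i *: V i (f i) = 0.
Proof.
move=> Dn u0 u1 uV.
(* As 0 is a mean of each class, no class lies in an open half-space bounded by a hyperplane through
   0. *)
have le0 i x : exists j, dot x (V i j) <= 0.
  apply: contrapT => /forallNP xV.
  have xV0 j : 0 < dot x (V i j) by rewrite ltNge; apply/negP/xV.
  have /eqP : dot x (\sum_j u i j *: V i j) = 0.
    by rewrite uV dot0r.
  rewrite dot_sumr; under eq_bigr do rewrite dotZr.
  rewrite psumr_eq0 => [/allP uxV|j _]; last by rewrite mulr_ge0// ltW.
  have : \sum_j u i j == 0.
    apply/eqP/big1 => j _; have := uxV j; rewrite mem_index_enum => /(_ isT)/=.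
    by rewrite mulf_eq0 (gt_eqF (xV0 j)) orbF => /eqP.
  by rewrite u1 oner_eq0.
pose M (f : {ffun 'I_n.+1 -> 'I_r}) := \matrix_i V i (f i).
have /boolp.choice[W WP] f : exists w, std_simplex w /\
    forall w', std_simplex w' -> dot (w *m M f) (w *m M f) <= dot (w' *m M f) (w' *m M f).
  by have [w] := nearest_point_simplex (M f); exists w.
have [j0 _] := le0 0 0.
case: (arg_minP (fun f => dot (W f *m M f) (W f *m M f))
  (P := xpredT) (i0 := [ffun=> j0]) isT) => f _ fmin.
have [Wf wmin] := WP f.
have [x0|x0] := eqVneq (W f *m M f) 0.
  exists f, (W f); split=> //.
  by rewrite -[RHS]x0 mulmx_sum_row; apply: eq_bigr => i _; rewrite rowK.
have [i|u' [i [u's u'x u'i]]] := nearest_point_drop (Dn : (D < n.+1)%N) Wf x0.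
  rewrite leNgt; apply/negP => /dot_segment_lt[t [t0 t1]].
  apply/negP; rewrite -leNgt rowE !scalemxAl -mulmxDl; apply: wmin.
  exact: std_simplex_segment (std_simplex_delta _ _).
have [j xj] := le0 i (W f *m M f).
pose g := [ffun i' => if i' == i then j else f i'].
have /dot_segment_lt[t [t0 t1]] :
    dot (W f *m M f) (V i j) < dot (W f *m M f) (W f *m M f).
  exact: le_lt_trans xj (dot_gt0 x0).
rewrite ltNge => /negP[]; apply: le_trans (fmin g isT) _.
have [_ /(_ ((1 - t) *: u' + t *: delta_mx 0 i))] := WP g.
rewrite mulmxDl -!scalemxAl -rowE rowK ffunE eqxx.
(* The exchanged vertex has weight 0 in [u'], so [x] also lies in the new simplex. *)
have -> : u' *m M g = W f *m M f.
  rewrite -u'x !mulmx_sum_row; apply: eq_bigr => k _; rewrite !rowK ffunE.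
  by case: eqP => // ->; rewrite u'i !scale0r.
by apply; exact: std_simplex_segment (std_simplex_delta _ _).
Qed.

(** * Tverberg's theorem *)

(* Sarkaria's tensor trick: [e j] are [r.+1] vectors of [R^r] whose only linear
   relation is [\sum_j e j = 0]. A vanishing rainbow combination of the tensors
   [e j (x) (a i, 1)] makes the partial sums over the colour classes agree. *)
Theorem tverberg (R : realType) (d r n : nat) (a : 'I_n -> 'rV[R]_d) :
  (r * (d + 1) < n)%N ->
  exists f : 'I_n -> 'I_r.+1, exists x, forall j,
    conv_hull (a @` [set` [set i | f i == j]%SET]) x.
Proof.
case: n a => // n a rdn.
pose e (j : 'I_r.+1) : 'rV[R]_r :=
  \row_k ((j == widen_ord (leqnSn r) k)%:R - (j == ord_max)%:R).
pose b i : 'rV[R]_(d + 1) := row_mx (a i) 1.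
have e0 : \sum_j e j = 0.
  have sum1 k : \sum_j (j == k)%:R = 1 :> R.
    by rewrite (bigD1 k)//= eqxx big1 ?addr0// => j /negPf ->.
  apply/rowP => k; rewrite summxE mxE; under eq_bigr do rewrite mxE.
  by rewrite sumrB !sum1 subrr.
pose V i j := mxvec ((e j)^T *m b i).
have [|||f [w [[w0 w1] wV]]] := @colorful_caratheodory R n r.+1 _ V
  (fun _ _ => r.+1%:R^-1) rdn.
- by move=> _ _; rewrite invr_ge0 ler0n.
- by move=> _; rewrite sumr_const card_ord -[_ *+ _]mulr_natr mulVf// pnatr_eq0.
- move=> i; rewrite -scaler_sumr -linear_sum/= -mulmx_suml -linear_sum/= e0.
  by rewrite linear0 mul0mx linear0 scaler0.
(* Entry [(k', l)] of the vanishing tensor is the sum over class [k'] minus the sum over the last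
   class. *)
have eq_sums (c : 'I_n.+1 -> R) : (exists l, forall i, c i = b i 0 l) ->
    forall k, \sum_(i | f i == k) w 0 i * c i =
              \sum_(i | f i == ord_max) w 0 i * c i.
  move=> [l cE] k; have [k' ->|->//] := unliftP ord_max k.
  have -> : lift ord_max k' = widen_ord (leqnSn r) k'.
    by apply: val_inj; rewrite /= /bump leqNgt ltn_ord.
  apply/eqP; rewrite -subr_eq0; apply/eqP.
  have /(congr1 (fun x => vec_mx x k' l)) := wV.
  rewrite linear_sum linear0 summxE [RHS]mxE; apply: etrans.
  rewrite big_mkcond [X in _ - X]big_mkcond -sumrB; apply: eq_bigr => i _ /=.
  rewrite linearZ/= mxvecK mxE mxE big_ord1 -cE [X in _ * (X * _)]mxE mxE.
  by case: (f i == _); case: (f i == _);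
    rewrite ?(subrr, subr0, sub0r, mul1r, mul0r, mulN1r, mulr0, mulrN).
(* The coordinate 1 appended in [b] makes the class weights equal, and they add up to 1. *)
have eq_w k : \sum_(i | f i == k) w 0 i = r.+1%:R^-1.
  have eq_max j : \sum_(i | f i == j) w 0 i = \sum_(i | f i == ord_max) w 0 i.
    have /(_ _ j) := eq_sums (fun=> 1); rewrite -!mulr_suml !mulr1; apply.
    by exists (rshift d 0) => i; rewrite /b row_mxEr mxE.
  have : \sum_j \sum_(i | f i == j) w 0 i = 1.
    by rewrite -w1 (partition_big f xpredT).
  under eq_bigr do rewrite eq_max.
  rewrite sumr_const card_ord -[LHS]mulr_natr eq_max => sumE.
  have rN0 : r.+1%:R != 0 :> R by rewrite pnatr_eq0.
  by apply: (mulIf rN0); rewrite sumE mulVf.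
exists f, (r.+1%:R *: \sum_(i | f i == ord_max) w 0 i *: a i) => j.
apply/conv_hullP; exists (fun i => (f i == j)%:R * (r.+1%:R * w 0 i)); split.
- by move=> i; rewrite !mulr_ge0 ?ler0n.
- by move=> i; rewrite inE => /negPf ->; rewrite mul0r.
- under eq_bigr do rewrite mulr_natl mulrb.
  by rewrite -big_mkcond -mulr_sumr eq_w divff// pnatr_eq0.
- rewrite scaler_sumr.
  apply/rowP => l; rewrite !summxE.
  under [RHS]eq_bigr do rewrite !mxE -mulrA mulr_natl mulrb -mulrA.
  rewrite -big_mkcond -mulr_sumr eq_sums; last first.
    by exists (lshift 1 l) => i; rewrite /b row_mxEl.
  by rewrite mulr_sumr; apply: eq_bigr => i _; rewrite !mxE.
Qed.

(** * Points spread over the rays *)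

(* [ray ord0] is [(-1, .., -1)], the other rays are the canonical basis. *)
Definition ray (R : realType) d (c : 'I_d.+1) : 'rV[R]_d :=
  \row_k ((c == lift ord0 k)%:R - (c == ord0)%:R).

(* The vectors [ray c] sum to 0, so coordinates are unique up to a common
   constant, which is 0 when both families are nonnegative with a zero. *)
Lemma ray_coord_inj (R : realType) d (y z : 'I_d.+1 -> R) :
  (forall c, 0 <= y c) -> (forall c, 0 <= z c) ->
  (exists c, y c = 0) -> (exists c, z c = 0) ->
  \sum_c y c *: ray R c = \sum_c z c *: ray R c -> y =1 z.
Proof.
move=> y0 z0 [c yc] [c' zc'] yz.
have coord (u : 'I_d.+1 -> R) k :
    (\sum_c u c *: ray R c) 0 k = u (lift ord0 k) - u ord0.
  have pick a : \sum_c u c * (c == a)%:R = u a.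
    rewrite (bigD1 a)//= eqxx mulr1 big1 ?addr0// => b /negPf ->.
    by rewrite mulr0.
  rewrite summxE; under eq_bigr do rewrite !mxE mulrBr.
  by rewrite sumrB !pick.
have shift b : y b - z b = y ord0 - z ord0.
  have [k ->|->//] := unliftP ord0 b.
  have := congr1 (fun x : 'rV_d => x 0 k) yz; rewrite !coord; lra.
have := shift c; have := shift c'; rewrite yc zc'.
have := y0 c'; have := z0 c => ? ? ? ? b; have := shift b; lra.
Qed.

Definition on_ray d (n : nat) (i : 'I_n) : 'I_d.+1 := inord (i %% d.+1).

(** The base [d.+2] exceeds the factor [d.+1] lost when a weight is only known to be at least
    [1 / d.+1]. *)
Definition height (R : realType) d (n : nat) (i : 'I_n) : R :=
  d.+2%:R ^+ (i %/ d.+1).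

Definition spread_points (R : realType) d n (i : 'I_n) : 'rV[R]_d :=
  height R d i *: ray R (on_ray d i).

Lemma height_gt0 (R : realType) d n (i : 'I_n) : 0 < height R d i.
Proof. by rewrite exprn_gt0// ltr0n. Qed.

Lemma on_ray_divn_inj d n (i i' : 'I_n) :
  on_ray d i = on_ray d i' -> (i %/ d.+1 = i' %/ d.+1)%N -> i = i'.
Proof.
move=> /(congr1 val)/=; rewrite !inordK ?ltn_mod// => mod_eq div_eq.
by apply: val_inj; rewrite /= (divn_eq i d.+1) div_eq mod_eq -divn_eq.
Qed.

Lemma height_gap (R : realType) d n (i i' : 'I_n) :
  on_ray d i = on_ray d i' -> i != i' ->
  d.+2%:R * height R d i <= height R d i' \/ d.+2%:R * height R d i' <= height R d i.
Proof.
move=> ii' iNi'; rewrite /height -!exprS !ler_eXn2l ?ltr1n//.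
case: (ltngtP (i %/ d.+1) (i' %/ d.+1)) => [||div_eq]; [by left|by right|].
by rewrite (on_ray_divn_inj ii' div_eq) eqxx in iNi'.
Qed.

(** Points on one ray share their residue modulo [d.+1], so their quotients, all below [r], are
    distinct. *)
Lemma card_on_ray d r n (c : 'I_d.+1) : (n <= d.+1 * r)%N ->
  (#|[set i : 'I_n | on_ray d i == c]%SET| <= r)%N.
Proof.
move=> nr.
have lt_r (i : 'I_n) : (i %/ d.+1 < r)%N.
  by rewrite ltn_divLR// mulnC (leq_trans (ltn_ord i)).
have inj : {in [set i : 'I_n | on_ray d i == c]%SET &,
    injective (fun i => Ordinal (lt_r i))}.
  move=> i i'; rewrite !inE => /eqP ic /eqP i'c /(congr1 val)/=.
  by apply: on_ray_divn_inj; rewrite ic i'c.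
by rewrite -(card_in_imset inj) -[r in (_ <= r)%N]card_ord max_card.
Qed.

(** * The lower bound *)

Lemma reay_property_lower_bound (R : realType) (d r k n : nat) :
  (d.+1 < k.*2)%N -> (k <= r.+1)%N -> (n <= d.+1 * r)%N ->
  ~ reay_property R d r.+1 k n.
Proof.
move=> dk kr nr /(_ (@spread_points R d n))[N [disjN covN capN]].
pose m (j : 'I_r.+1) (c : 'I_d.+1) := #|[set i in N j | on_ray d i == c]%SET|.
(* A ray carries at most [r] points, each counted once at most because the parts are disjoint. *)
have sum_m c : (\sum_j m j c < #|'I_r.+1|)%N.
  rewrite card_ord ltnS; apply: leq_trans (card_on_ray c nr).
  rewrite /m; under eq_bigr do rewrite -sum1_card.
  under eq_bigr do under eq_bigl do rewrite inE.
  under eq_bigr do rewrite big_mkcondr big_mkcond.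
  rewrite exchange_big -sum1_card [leqRHS]big_mkcond; apply: leq_sum => i _.
  rewrite inE; case: eqP => _; last by rewrite big1// => j _; case: ifP.
  rewrite -big_mkcond sum1_card; apply/card_le1P => j; rewrite unfold_in => ij j'.
  rewrite unfold_in inE; apply/idP/eqP => [ij'|->//].
  apply/eqP; apply: contraTT ij => jj'.
  by move: (disjN _ _ jj'); rewrite disjoint_subset => /fintype.subsetP/(_ i ij').
have [|J [S [Jk Jmiss SJ SG]]] := few_parts_missing_rays (k := k) _ sum_m.
  by rewrite card_ord.
set G := [set j in J | _]%SET in SG.
(* [J] may have fewer than [k] parts, while common points are provided for exactly [k]. *)
have [K JK /capN[x Kx]] : exists2 K : {set 'I_r.+1}, J \subset K & #|K| = k.
  by apply: superset_of_card; rewrite Jk card_ord.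
have /boolp.choice[w wP] j : exists w : 'I_n -> R, j \in J ->
    [/\ forall i, 0 <= w i, forall i, i \notin N j -> w i = 0,
        \sum_i w i = 1 & x = \sum_i w i *: spread_points R d i].
  case: (boolP (j \in J)) => [jJ|_]; last by exists (fun=> 0).
  have /conv_hullP[w wP] := Kx j (fintype.subsetP JK j jJ).
  by exists w.
(* The coordinate of [x] along ray [c], as computed from the weights of part [j]. *)
pose y j c := \sum_(i | on_ray d i == c) w j i * height R d i.
have y_ge0 j c : j \in J -> 0 <= y j c.
  by move=> /wP[w0 _ _ _]; apply: sumr_ge0 => i _; rewrite mulr_ge0// ltW// height_gt0.
have y_miss j c : j \in J -> m j c = 0%N -> y j c = 0.
  move=> /wP[_ wN _ _] /cards0_eq mjc; apply: big1 => i ic.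
  rewrite wN ?mul0r//; apply/negP => iN.
  by have : i \in finset.set0 by [rewrite -mjc inE iN]; rewrite inE.
have y_sum j : j \in J -> x = \sum_c y j c *: ray R c.
  move=> /wP[_ _ _ ->]; rewrite (partition_big (@on_ray d n) xpredT)//=.
  apply: eq_bigr => c _; rewrite scaler_suml; apply: eq_bigr => i /eqP ic.
  by rewrite /spread_points scalerA ic.
have y_eq j j' : j \in J -> j' \in J -> y j =1 y j'.
  move=> jJ j'J; apply: ray_coord_inj.
  - by move=> c; exact: y_ge0.
  - by move=> c; exact: y_ge0.
  - by have [c] := Jmiss j jJ; exists c; exact: y_miss.
  - by have [c] := Jmiss j' j'J; exists c; exact: y_miss.
  - by rewrite -!y_sum.
have y_S j c : j \in J -> c \notin S -> y j c = 0.
  by move=> jJ /SJ[j' j'J mj'c]; rewrite (y_eq j j')// y_miss.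
(* Some ray gets weight at least [1 / d.+1] from part [j]. It lies in [S], as [y j] is positive on
   it, so a single point [i] of the part carries that weight and [y] there is
   [w j i * height R d i]. *)
have heavy j : j \in G -> exists i, [/\ i \in N j, on_ray d i \in S,
    height R d i <= d.+1%:R * y j (on_ray d i) & y j (on_ray d i) <= height R d i].
  rewrite inE => /andP[jJ /forall_inP m1]; have [w0 wN w1 _] := wP j jJ.
  have [c wc] : exists c, d.+1%:R^-1 <= \sum_(i | on_ray d i == c) w j i.
    apply: contrapT => /forallNP wlt.
    have : \sum_c \sum_(i | on_ray d i == c) w j i < \sum_(c < d.+1) d.+1%:R^-1.
      rewrite !big_ord_recl ltr_leD//; first by rewrite ltNge; apply/negP.
      by apply: ler_sum => c _; rewrite leNgt; apply/negP => /ltW /wlt.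
    have -> : \sum_c \sum_(i | on_ray d i == c) w j i = 1.
      by rewrite -w1 [RHS](partition_big (@on_ray d n) xpredT).
    rewrite sumr_const card_ord.
    by rewrite -[ltRHS]mulr_natl divff ?ltxx// pnatr_eq0.
  have wc0 : 0 < \sum_(i | on_ray d i == c) w j i.
    by apply: lt_le_trans wc; rewrite invr_gt0 ltr0n.
  have [i ic wi] : exists2 i, on_ray d i = c & 0 < w j i.
    apply: contrapT => /forall2NP noi; move: wc0; rewrite big1 ?ltxx// => i /eqP ic.
    apply/eqP; rewrite eq_le w0 andbT leNgt; apply/negP.
    by have [] := noi i.
  have iN : i \in N j by apply: contraTT wi => /wN ->; rewrite ltxx.
  have cS : c \in S.
    apply: contraTT wi => /(y_S j _ jJ) /eqP; rewrite psumr_eq0 => [/allP/(_ i)|i' _].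
      rewrite mem_index_enum ic eqxx mulf_eq0 => /(_ isT)/=.
      by rewrite (gt_eqF (height_gt0 _ _ _)) orbF => /eqP ->; rewrite ltxx.
    by rewrite mulr_ge0// ltW// height_gt0.
  have uniq_i i' : on_ray d i' == c -> i' != i -> w j i' = 0.
    move=> i'c i'i; apply: wN; apply: contra i'i => i'N.
    have /card_le1P/(_ i) := m1 c cS; rewrite !inE iN ic eqxx => /(_ isT)/(_ i').
    by rewrite !inE i'N i'c => <-.
  have sum_i F : \sum_(i' | on_ray d i' == c) w j i' * F i' = w j i * F i :> R.
    rewrite (bigD1 i) ?ic//= big1 ?addr0// => i' /andP[i'c /uniq_i ->//].
    by rewrite mul0r.
  move: wc; have := sum_i (fun=> 1); rewrite -mulr_suml !mulr1 => -> wc.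
  exists i; rewrite ic /y sum_i; split=> //.
    rewrite mulrA ler_peMl ?(ltW (height_gt0 _ _ _))//.
    by rewrite -ler_pdivrMl ?ltr0n// mulr1.
  rewrite ler_piMl ?(ltW (height_gt0 _ _ _))// -w1 (bigD1 i)//= lerDl.
  exact: sumr_ge0.
(* This only yields an index [i0], the default value of [h] outside [G]. *)
have [j0 j0G] : exists j, j \in G by apply/card_gt0P; exact: leq_ltn_trans SG.
have [i0 _] := heavy j0 j0G.
have /boolp.choice[h hP] j : exists i, j \in G -> [/\ i \in N j, on_ray d i \in S,
    height R d i <= d.+1%:R * y j (on_ray d i) & y j (on_ray d i) <= height R d i].
  by case: (boolP (j \in G)) => [/heavy[i]|_]; [exists i | exists i0].
have GJ j : j \in G -> j \in J by rewrite inE => /andP[].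
(* An injection of [G] into [S] contradicts [#|S| < #|G|]. *)
suff inj : {in G &, injective (fun j => on_ray d (h j))}.
  have := card_in_imset inj; apply/eqP; rewrite neq_ltn (leq_ltn_trans _ SG)//.
  by apply/subset_leq_card/fintype.subsetP => _ /imsetP[j /hP[_ ? _ _] ->].
suff gap j j' : j \in G -> j' \in G -> on_ray d (h j) = on_ray d (h j') ->
    d.+2%:R * height R d (h j) <= height R d (h j') -> False.
  move=> j j' jG j'G hh; apply/eqP/negPn/negP => jj'.
  have hNh : h j != h j'.
    have [hj _ _ _] := hP j jG; have [hj' _ _ _] := hP j' j'G.
    apply: contraTneq hj => ->; apply/negP => hj.
    by have := disjN _ _ jj'; rewrite disjoint_subset => /fintype.subsetP/(_ _ hj);
      rewrite !inE hj'.
  by have [/gap|/gap] := height_gap R hh hNh; apply.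
move=> jG j'G hh hgap.
have [_ _ _ le_h] := hP j jG; have [_ _ h'_le _] := hP j' j'G.
have : d.+1%:R * y j (on_ray d (h j)) <= d.+1%:R * height R d (h j).
  by rewrite ler_pM2l ?ltr0n.
(* Both parts give [x] the same coordinate on the shared ray, so the higher point is at most [d.+1]
   times as high as the lower one, against the gap [d.+2]. *)
rewrite (y_eq j j') ?GJ// hh => /(le_trans h'_le)/(le_trans hgap).
by rewrite ler_pM2r ?height_gt0// ler_nat ltnn.
Qed.

(** * The upper bound and the value of [T] *)

Lemma reay_property_tverberg (R : realType) (d r k n : nat) :
  (r * (d + 1) < n)%N -> reay_property R d r.+1 k n.
Proof.
move=> rdn a; have [f [x fx]] := tverberg a rdn.
exists (fun j => [set i | f i == j]%SET); split=> [i j ij||J _].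
- rewrite disjoint_subset; apply/fintype.subsetP => i'; rewrite !inE => /eqP ->.
  by [].
- by apply/setP => i; rewrite !inE; apply/bigcupP; exists (f i); rewrite ?inE.
- by exists x => j _; exact: fx.
Qed.

Local Close Scope ring_scope.
Local Close Scope classical_set_scope.

Theorem theorem2 (R : realType) (d r : nat) :
  (3 <= d)%N -> ((d + 3) %/ 2 <= r)%N ->
  T R d r ((d + 3) %/ 2) = ((d + 1) * (r - 1) + 1)%N.
Proof.
move=> d3 kr; have [r' rE] : exists r', r = r'.+1 by exists r.-1; lia.
move: kr; rewrite {}rE subn1 /= => kr.
have upper : reay_property R d r'.+1 ((d + 3) %/ 2) ((d + 1) * r' + 1).
  by apply: reay_property_tverberg; lia.
rewrite /T; case: pselect => [ex_n|[]]; last first.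
  by exists ((d + 1) * r' + 1)%N; apply/asboolP; split=> //; lia.
case: ex_minnP => n /asboolP[n0 nP] nmin.
apply/eqP; rewrite eqn_leq; apply/andP; split.
  by apply: nmin; apply/asboolP; split=> //; lia.
(* The bound [d.+1 < k.*2] holds since twice [(d + 3) %/ 2] is at least [d + 2]. *)
rewrite leqNgt; apply/negP => ltn; apply: reay_property_lower_bound nP; lia.
Qed.
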